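(* Let $G$ be a countable abelian group and suppose $(X,\mu)$ is an ergodic $G$-space. If $A\subset G$ is an ergodic basis of order $k$ with respect to $(X,\mu)$, then $$\mu(AB)\ \ge\ \mu(B)^{1-\frac1k}$$ for every measurable subset $B\subset X$.
   Context: A $G$-space $(X,\mu)$ is a probability measure space such that the Hilbert space $L^2(X,\mu)$ is separable, on which $G$ acts by bi-measurable bijections which preserve $\mu$. It is ergodic if there is no $G$-invariant measurable set $B\subset X$ with $0<\mu(B)<1$. For $A\subset G$ and measurable $B\subset X$, $AB=\bigcup_{a\in A}aB$. For $A\subset G$, $A^k=\{a_1\cdots a_k : a_1,\dots,a_k\in A\}$ is the $k$-fold product set of $A$ with itself. For an ergodic $G$-space $(X,\mu)$, a set $A\subset G$ is an ergodic set with respect to $(X,\mu)$ if $\mu(AB)=1$ for every measurable $B\subset X$ of positive $\mu$-measure. A set $A\subset G$ is an ergodic basis of order $k$ with respect to $(X,\mu)$ if $A^k$ is an ergodic set with respect to $(X,\mu)$.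
   Formalization: For k = 1 the set B is assumed to have positive measure, since for μ(B) = 0 the bound would read 0^0 (undefined; with 0^0 = 1 it fails for B empty); k is a positive integer. *)

(* Defs.v *)
From mathcomp Require Import all_boot all_order all_algebra.
From mathcomp Require Import all_classical all_reals all_analysis.

Set Implicit Arguments.
Unset Strict Implicit.
Unset Printing Implicit Defensive.

Import Order.TTheory GRing.Theory Num.Theory.

Local Open Scope classical_set_scope.
Local Open Scope ring_scope.

(* Elements of [LspaceType2 mu] are a.e.-equality classes of real-valued
   functions; the norm is taken on representatives, on which it does not
   depend.  The real L^2 space is separable iff the complex one is. *)
Definition L2_separable d (X : measurableType d) (R : realType)
    (mu : {measure set X -> \bar R}) : Prop :=
  exists2 D : set (LspaceType2 mu), countable D &
    forall (f : LspaceType2 mu) (e : R), 0 < e ->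
      exists2 g : LspaceType2 mu, D g &
        ('N[mu]_2%:E [EFin \o (fun x => (f x - g x)%R)] < e%:E)%E.

(* Each [act g] is a bijection with inverse [act g^-1], so measurability for
   all [g] gives bi-measurability. *)
Record is_Gspace (G : groupType) d (X : measurableType d) (R : realType)
    (mu : probability X R) (act : G -> X -> X) : Prop := IsGspace {
  Gspace_act1 : forall x, act 1%g x = x;
  Gspace_actM : forall (g h : G) x, act (g * h)%g x = act g (act h x);
  Gspace_measurable : forall g, measurable_fun [set: X] (act g);
  Gspace_preserving : forall g (B : set X), measurable B ->
    mu (act g @^-1` B) = mu B;
  Gspace_separable : L2_separable mu
}.

Definition ergodic_action (G : groupType) d (X : measurableType d)
    (R : realType) (mu : probability X R) (act : G -> X -> X) : Prop :=
  ~ exists B : set X, [/\ measurable B, forall g, act g @` B = B &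
                          (0 < mu B < 1)%E].

Definition act_set (G X : Type) (act : G -> X -> X) (A : set G) (B : set X) :
    set X :=
  \bigcup_(a in A) (act a @` B).

Definition prodset (G : groupType) (A : set G) (k : nat) : set G :=
  [set g | exists2 a : 'I_k -> G, (forall i, A (a i)) &
                                  g = (\prod_(i < k) a i)%g].

Definition ergodic_set (G : groupType) d (X : measurableType d)
    (R : realType) (mu : probability X R) (act : G -> X -> X)
    (A : set G) : Prop :=
  forall B : set X, measurable B -> (0 < mu B)%E ->
    mu (act_set act A B) = 1%E.

Definition ergodic_basis (G : groupType) d (X : measurableType d)
    (R : realType) (mu : probability X R) (act : G -> X -> X)
    (k : nat) (A : set G) : Prop :=
  ergodic_set mu act (prodset A k).

(* Main.v *)
Require Import Defs.
From mathcomp Require Import all_boot all_order all_algebra.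
From mathcomp Require Import all_classical all_reals all_analysis.
From mathcomp Require Import lra.
Import Order.TTheory GRing.Theory Num.Theory numFieldNormedType.Exports.

Local Open Scope classical_set_scope.
Local Open Scope ring_scope.

(** Suppose the inequality fails, and pick a real l with
    mu(AB) / mu(B) < l < mu(B) ^ (-1/k).  A Plünnecke inequality, proved by
    Petridis' method, produces D inside B with mu(D) > 0 and
    mu(A^k D) <= l^k mu(D) <= l^k mu(B) < 1, which contradicts mu(A^k D) = 1.

    Petridis' method studies Phi(S) = mu(AS) - l mu(S), called the excess below.
    The set D should be a hereditary minimizer of Phi: no measurable subset of D
    has smaller excess.  In a finite group such a set is found by minimizing over
    the subsets of B.  In a measure space a greedy construction replaces this
    ([hereditary_minimizer]): choose D_0 = B and D_(n+1) inside D_n within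
    1/(n+1) of optimal among its own subsets, and take D to be the intersection.
    The measure of D_n converges to that of D, and S |-> mu(AS) is monotone; this
    is enough for the near-optimality to become optimality in the limit.  The
    choice of l gives Phi(D) <= Phi(B) < 0, so D is not null.

    Two features of Phi then carry the inequality.  It is submodular, since
    A(S u T) = AS u AT and A(S n T) is contained in AS n AT; and it is invariant
    under translation, since G is abelian and preserves mu.  If c is in G and Z
    is measurable, then Z n cD is a translate of a subset of D, so
    Phi(Z n cD) >= Phi(D) = Phi(cD), and submodularity gives
    Phi(Z u cD) <= Phi(Z).  Starting from the empty set and adding the translates
    cD, c in C, one at a time yields mu(ACD) <= l mu(CD) for finite C, and then
    for every C by continuity from below ([petridis]).  Taking C = A^j for
    j = 0, ..., k - 1 gives mu(A^k D) <= l^k mu(D). *)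

(** * Hereditary minimizers of penalized monotone set functions *)

Section FiniteMeasure.
Context {d : measure_display} {X : measurableType d} {R : realType}.
Variable mu : {finite_measure set X -> \bar R}.

(** On measurable sets [mu] is finite; working with its real values makes
    subtraction and linear arithmetic available. *)
Definition mass (S : set X) : R := fine (mu S).

Lemma massE S : measurable S -> mu S = (mass S)%:E.
Proof. by move=> mS; rewrite /mass fineK// fin_num_measure. Qed.

Lemma mass_lty S : measurable S -> (mu S < +oo)%E.
Proof. by move=> mS; rewrite massE// ltry. Qed.

Lemma mass_ge0 S : 0 <= mass S.
Proof. exact/fine_ge0/measure_ge0. Qed.

Lemma le_mass S T : measurable S -> measurable T -> S `<=` T ->
  mass S <= mass T.
Proof.
by move=> mS mT ST; rewrite -lee_fin -!massE// le_measure// inE.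
Qed.

Lemma mass_setU S T : measurable S -> measurable T ->
  mass (S `|` T) = mass S + mass T - mass (S `&` T).
Proof.
move=> mS mT; apply: EFin_inj; rewrite EFinB EFinD -!massE//.
- by rewrite measureUfinl//; exact: mass_lty.
- exact: measurableI.
- exact: measurableU.
Qed.

Lemma cvg_mass_bigcup (F : (set X)^nat) : (forall n, measurable (F n)) ->
  nondecreasing_seq F -> mass (F n) @[n --> \oo] --> mass (\bigcup_n F n).
Proof.
move=> mF ndF; have mU : measurable (\bigcup_n F n) by exact: bigcup_measurable.
by apply: fine_cvg; rewrite -massE//; apply: nondecreasing_cvg_mu.
Qed.

Lemma cvg_mass_bigcap (F : (set X)^nat) : (forall n, measurable (F n)) ->
  nonincreasing_seq F -> mass (F n) @[n --> \oo] --> mass (\bigcap_n F n).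
Proof.
move=> mF niF; have mI : measurable (\bigcap_n F n) by exact: bigcap_measurable.
apply: fine_cvg; rewrite -massE//; apply: nonincreasing_cvg_mu => //.
exact: mass_lty.
Qed.

Definition excess (f : set X -> R) (l : R) (S : set X) : R := f S - l * mass S.

(** A nearly optimal subset D of B works, as every subset of D competes with D
    for the infimum of the excess over the subsets of B. *)
Lemma near_hereditary_minimizer (f : set X -> R) (l e : R) (B : set X) :
  (forall S T, measurable S -> measurable T -> S `<=` T -> f S <= f T) ->
  0 <= l -> 0 < e -> measurable B ->
  exists D, [/\ measurable D, D `<=` B, excess f l D <= excess f l B &
    forall E, measurable E -> E `<=` D -> excess f l D - e <= excess f l E].
Proof.
move=> f_mono l0 e0 mB.
pose V := [set excess f l E | E in [set E | measurable E /\ E `<=` B]].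
have Vinf : has_inf V.
  split; first by exists (excess f l B); exists B => //; split.
  exists (f set0 - l * mass B) => _ [E [mE EB] <-].
  by rewrite lerB// ?f_mono// ler_wpM2l// le_mass.
have leV E : measurable E -> E `<=` B -> inf V <= excess f l E.
  by move=> mE EB; apply: ge_inf; [exact: Vinf.2|exists E].
(* Keeping B itself when it is already nearly optimal ensures that the excess
   of D never exceeds that of B. *)
have [small|large] := ltP (excess f l B) (inf V + e).
  exists B; split=> // E mE EB.
  by rewrite lerBlDr (le_trans (ltW small))// lerD2r leV.
have [_ [D [mD DB] <-] Dlt] := inf_adherent e0 Vinf.
exists D; split=> // [|E mE ED]; first exact: ltW (lt_le_trans Dlt large).
rewrite lerBlDr (le_trans (ltW Dlt))// lerD2r leV//.
exact: subset_trans ED DB.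
Qed.

(** A minimizing sequence of subsets of B may oscillate.  Nesting the choices
    forces convergence: along a decreasing sequence the penalty [l * mass]
    converges, while monotonicity of [f] bounds the excess of the intersection
    from above. *)
Lemma hereditary_minimizer (f : set X -> R) (l : R) (B : set X) :
  (forall S T, measurable S -> measurable T -> S `<=` T -> f S <= f T) ->
  0 <= l -> measurable B ->
  exists D, [/\ measurable D, D `<=` B, excess f l D <= excess f l B &
    forall E, measurable E -> E `<=` D -> excess f l D <= excess f l E].
Proof.
move=> f_mono l0 mB.
pose next n (S T : set X) := measurable S -> [/\ measurable T, T `<=` S,
  excess f l T <= excess f l S & forall E, measurable E -> E `<=` T ->
    excess f l T - n.+1%:R^-1 <= excess f l E].
have /choice[F Fnext] : forall p : nat * set X, exists T, next p.1 p.2 T.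
  move=> [n S]; case: (pselect (measurable S)) => [mS|nmS]; last first.
    by exists set0 => /nmS.
  have [|T HT] := @near_hereditary_minimizer f l n.+1%:R^-1 S f_mono l0 _ mS.
    by rewrite invr_gt0.
  by exists T => _.
(* The stage is passed along with the set because the tolerance depends on it. *)
pose D := fix D n := if n is m.+1 then F (m, D m) else B.
have mD n : measurable (D n) by elim: n => //= n /(Fnext (n, _))[].
have DS n : D n.+1 `<=` D n by case: (Fnext (n, _) (mD n)).
have niD : nonincreasing_seq D.
  by apply/nonincreasing_seqP => n; apply/subsetPset; exact: DS.
have leB n : excess f l (D n) <= excess f l B.
  elim: n => //= n IH; have [_ _ step _] := Fnext (n, _) (mD n).
  exact: le_trans step IH.
have cvD := cvg_mass_bigcap D mD niD.
have mI : measurable (\bigcap_n D n) by exact: bigcap_measurable.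
have cvexcess : f (\bigcap_n D n) - l * mass (D n) @[n --> \oo] -->
    excess f l (\bigcap_n D n).
  by apply: cvgB; [exact: cvg_cst|exact: cvgMl_tmp].
have f_le n : f (\bigcap_n D n) - l * mass (D n) <= excess f l (D n).
  by rewrite lerD2r f_mono//; exact: bigcap_inf.
exists (\bigcap_n D n); split=> //.
- exact: (bigcap_inf (i := 0%N)).
- apply: (cvgr_to_le cvexcess); near=> n; exact: le_trans (f_le n) (leB n).
- move=> E mE ED; rewrite -[leRHS]addr0.
  have cvsum : excess f l E + n.+1%:R^-1 @[n --> \oo] --> excess f l E + 0.
    by apply: cvgD; [exact: cvg_cst|exact: cvg_harmonic].
  apply: (ler_cvg_to _ cvsum).
    by rewrite -(cvg_shiftS (fun n => _)) in cvexcess; exact: cvexcess.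
  near=> n; have [_ _ _ Dmin] := Fnext (n, _) (mD n).
  rewrite (le_trans (f_le n.+1))// -lerBlDr Dmin//.
  exact: subset_trans ED (@bigcap_inf _ _ n.+1 setT D I).
Unshelve. all: by end_near. Qed.
End FiniteMeasure.

(** * Product sets AS under an action *)

Section ActionSets.
Context {G X : Type} (act : G -> X -> X).
Implicit Types (A C : set G) (S T : set X).

Lemma act_setS A C S T : A `<=` C -> S `<=` T ->
  act_set act A S `<=` act_set act C T.
Proof. by move=> AC ST x [a /AC Ca [y /ST Ty <-]]; exists a => //; exists y. Qed.

Lemma act_set_bigcup I (P : set I) A (F : I -> set X) :
  act_set act A (\bigcup_(i in P) F i) = \bigcup_(i in P) act_set act A (F i).
Proof.
apply/seteqP; split=> [x [a Aa [y [i Pi Fy] <-]]|x [i Pi [a Aa [y Fy <-]]]].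
- by exists i => //; exists a => //; exists y.
- by exists a => //; exists y => //; exists i.
Qed.

Lemma act_setUr A S T :
  act_set act A (S `|` T) = act_set act A S `|` act_set act A T.
Proof.
by rewrite /act_set -bigcupU; apply: eq_bigcupr => a _; exact: image_setU.
Qed.

Lemma act_setUl A C S :
  act_set act (A `|` C) S = act_set act A S `|` act_set act C S.
Proof. exact: bigcup_setU. Qed.

Lemma act_set1 c S : act_set act [set c] S = act c @` S.
Proof. exact: bigcup_set1. Qed.

End ActionSets.

(** * Petridis' argument in a G-space *)

Section Gspace.
Context {G : groupType} {d : measure_display} {X : measurableType d}
  {R : realType} {mu : probability X R} {act : G -> X -> X}.
Hypothesis G_countable : countable [set: G].
Hypothesis G_abelian : forall g h : G, (g * h = h * g)%g.
Hypothesis Gsp : is_Gspace mu act.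
Implicit Types (A C : set G) (S T : set X).

Lemma actK g : cancel (act g) (act g^-1%g).
Proof.
by move=> x; rewrite -(Gspace_actM Gsp) mulVg (Gspace_act1 Gsp).
Qed.

Lemma act_image g S : act g @` S = act g^-1%g @^-1` S.
Proof.
apply/seteqP; split=> [_ [x Sx <-]|x Sx] /=; first by rewrite actK.
by exists (act g^-1%g x) => //; rewrite -{1}(invgK g) actK.
Qed.

Lemma measurable_act_image g S : measurable S -> measurable (act g @` S).
Proof.
by move=> mS; rewrite act_image -[_ @^-1` _]setTI; exact: (Gspace_measurable Gsp).
Qed.

Lemma mass_act_image g S : measurable S -> mass mu (act g @` S) = mass mu S.
Proof.
move=> mS; congr fine; rewrite act_image; exact: (Gspace_preserving Gsp).
Qed.

Lemma measurable_act_set A S : measurable S -> measurable (act_set act A S).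
Proof.
move=> mS; rewrite /act_set bigcup_mkcond.
apply: countable_bigcupT_measurable => // a.
by case: ifP => _ //; exact: measurable_act_image.
Qed.

(** The translations by a and by c commute: this is where G being abelian
    enters. *)
Lemma act_set_image A c S :
  act_set act A (act c @` S) = act c @` act_set act A S.
Proof.
apply/seteqP; split=> [_ [a Aa [_ [x Sx <-] <-]]|_ [_ [a Aa [x Sx <-]] <-]].
- exists (act a x); first by exists a => //; exists x.
  by rewrite -!(Gspace_actM Gsp) G_abelian.
- exists a => //; exists (act c x); first by exists x.
  by rewrite -!(Gspace_actM Gsp) G_abelian.
Qed.

Definition act_excess A (l : R) : set X -> R :=
  excess mu (fun S => mass mu (act_set act A S)) l.

(** The mass term is modular, so only the inclusion of A(S n T) in AS n AT
    contributes to the inequality. *)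
Lemma act_excess_submodular A l S T : measurable S -> measurable T ->
  act_excess A l (S `|` T) + act_excess A l (S `&` T) <=
  act_excess A l S + act_excess A l T.
Proof.
move=> mS mT; have mA := @measurable_act_set A.
have sub : mass mu (act_set act A (S `&` T)) <=
    mass mu (act_set act A S `&` act_set act A T).
  apply: le_mass; [exact/mA/measurableI|by apply: measurableI; exact: mA|].
  by rewrite subsetI; split; apply: act_setS => // x [].
rewrite /act_excess /excess act_setUr !mass_setU//; [|exact: mA..].
lra.
Qed.

Lemma act_excess_image A l c S : measurable S ->
  act_excess A l (act c @` S) = act_excess A l S.
Proof.
move=> mS; rewrite /act_excess /excess act_set_image !mass_act_image//.
exact: measurable_act_set.
Qed.

Section Petridis.
Variables (A : set G) (l : R) (D : set X).
Hypothesis l_ge0 : 0 <= l.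
Hypothesis mD : measurable D.
Hypothesis D_min : forall E, measurable E -> E `<=` D ->
  act_excess A l D <= act_excess A l E.

(** Submodularity reduces this to comparing cD with Z n cD; translating by the
    inverse of c turns Z n cD into a subset of D, against which D is minimal. *)
Lemma act_excess_setU_translate Z c : measurable Z ->
  act_excess A l (Z `|` act c @` D) <= act_excess A l Z.
Proof.
move=> mZ; have mcD := measurable_act_image c D mD.
have := act_excess_submodular A l _ _ mZ mcD.
suff : act_excess A l (act c @` D) <= act_excess A l (Z `&` act c @` D) by lra.
have mW : measurable (Z `&` act c @` D) by exact: measurableI.
rewrite act_excess_image// -(act_excess_image A l c^-1%g _ mW).
apply: D_min; first exact: measurable_act_image.
by move=> _ [_ [_ [x Dx <-]] <-]; rewrite actK.
Qed.

(** C is exhausted by the finite sets Cn of elements whose index in an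
    enumeration of G is less than n; each step adds at most one translate of D
    and does not increase the excess, which starts at 0. *)
Lemma petridis C :
  mass mu (act_set act A (act_set act C D)) <= l * mass mu (act_set act C D).
Proof.
have /countable_injP[f f_inj] := G_countable.
pose Cn n := C `&` [set c | (f c < n)%N].
have mCn n : measurable (act_set act (Cn n) D) by exact: measurable_act_set.
have Cn_le n : act_excess A l (act_set act (Cn n) D) <= 0.
  elim: n => [|n IH].
    have -> : Cn 0%N = set0 by apply/seteqP; split=> // c [].
    rewrite /act_excess /excess {2 3}/act_set !bigcup_set0.
    have -> : act_set act A set0 = set0.
      by rewrite -(@bigcup_set0 _ X (fun _ => set0)) act_set_bigcup !bigcup_set0.
    by rewrite /mass measure0 mulr0 subrr.
  have [[c Cc fc]|no] := pselect (exists2 c, C c & f c = n).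
    have -> : Cn n.+1 = Cn n `|` [set c].
      apply/seteqP; split=> [b [Cb]|b [[Cb /= fb]|/= ->]] /=.
      - rewrite ltnS leq_eqVlt => /orP[/eqP fb|]; [right|by left].
        by apply: f_inj; rewrite ?inE// fb fc.
      - by split=> //=; exact: ltnW.
      - by split; rewrite /= ?fc.
    rewrite act_setUl act_set1.
    exact: le_trans (act_excess_setU_translate _ _ _) IH.
  suff -> : Cn n.+1 = Cn n by [].
  apply/seteqP; split=> b [Cb] /=; last by move=> fb; split=> //=; exact: ltnW.
  rewrite ltnS leq_eqVlt => /orP[/eqP fb|//].
  by case: no; exists b.
have CnE : act_set act C D = \bigcup_n act_set act (Cn n) D.
  apply/seteqP; split=> [x [c Cc Dx]|x [n _ [c [Cc _] Dx]]]; last by exists c.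
  by exists (f c).+1 => //; exists c => //; split=> /=.
have Cn_nd : nondecreasing_seq (fun n => act_set act (Cn n) D).
  move=> m n mn; apply/subsetPset/act_setS => // c [Cc /= fc].
  by split=> //=; exact: leq_trans fc mn.
have ACn_nd : nondecreasing_seq (fun n => act_set act A (act_set act (Cn n) D)).
  by move=> m n /Cn_nd/subsetPset ?; apply/subsetPset/act_setS.
have cv := cvg_mass_bigcup mu _ (fun n => measurable_act_set A _ (mCn n)) ACn_nd.
rewrite -act_set_bigcup -CnE in cv.
apply: (cvgr_to_le cv); near=> n.
apply: (@le_trans _ _ (l * mass mu (act_set act (Cn n) D))).
  by rewrite -subr_le0; exact: Cn_le.
rewrite ler_wpM2l// le_mass//; first exact: measurable_act_set.
by apply: act_setS => // c [].
Unshelve. all: by end_near. Qed.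

Lemma prodset_mass_le k :
  mass mu (act_set act (prodset A k) D) <= l ^+ k * mass mu D.
Proof.
elim: k => [|k IH].
  rewrite expr0 mul1r le_mass//; first exact: measurable_act_set.
  move=> _ [_ [a _ ->] [x Dx <-]].
  by rewrite big_ord0 (Gspace_act1 Gsp).
apply: (@le_trans _ _
    (mass mu (act_set act A (act_set act (prodset A k) D)))).
  apply: le_mass; [exact: measurable_act_set| |].
    exact/measurable_act_set/measurable_act_set.
  move=> _ [_ [a Aa ->] [x Dx <-]].
  rewrite big_ord_recl (Gspace_actM Gsp); exists (a ord0) => //.
  eexists; last by []; exists (\prod_(i < k) a (lift ord0 i))%g.
    by exists (a \o lift ord0) => // i; exact: Aa.
  by exists x.
by rewrite (le_trans (petridis _))// exprS -mulrA ler_wpM2l.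
Qed.

End Petridis.

(** The strict hypothesis says that B has negative excess; a hereditary minimizer
    inside B has negative excess too, and a null set cannot. *)
Lemma plunnecke A (l : R) (B : set X) : measurable B ->
  mass mu (act_set act A B) < l * mass mu B ->
  exists D, [/\ measurable D, D `<=` B, 0 < mass mu D &
    forall k, mass mu (act_set act (prodset A k) D) <= l ^+ k * mass mu D].
Proof.
move=> mB AB_lt.
have l_ge0 : 0 <= l.
  have := mass_ge0 mu B; have := mass_ge0 mu (act_set act A B); nra.
have [|D [mD DB D_lt D_min]] := @hereditary_minimizer _ _ _ mu
    (fun S => mass mu (act_set act A S)) l B _ l_ge0 mB.
  move=> S T mS mT ST.
  by apply: le_mass; [exact: measurable_act_set..|exact: act_setS].
exists D; split=> // [|k]; last exact: prodset_mass_le.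
rewrite lt_neqAle mass_ge0 andbT; apply/eqP => D0.
move: D_lt; rewrite /excess -D0.
have := mass_ge0 mu (act_set act A D); lra.
Qed.

End Gspace.

(** * From the Plünnecke inequality to the exponent 1 - 1/k *)

(** The number r = b ^ (-1/k) solves r^k b = 1, so a < b ^ (1 - 1/k) means
    a / b < r, and any l strictly between the two contradicts the hypothesis. *)
Lemma powR_le_of_expr_le (R : realType) (k : nat) (a b : R) :
  (0 < k)%N -> 0 <= a -> 0 < b ->
  (forall l, a < l * b -> 1 <= l ^+ k * b) -> b `^ (1 - k%:R^-1) <= a.
Proof.
move=> k0 a0 b0 H; rewrite leNgt; apply/negP => a_lt.
have k_neq0 : k%:R != 0 :> R by rewrite pnatr_eq0 -lt0n.
set r := b `^ (- k%:R^-1).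
have rE : b `^ (1 - k%:R^-1) = r * b.
  by rewrite powRD ?(gt_eqF b0) ?implybT// powRr1 1?mulrC// ltW.
have rk : r ^+ k * b = 1.
  rewrite -powR_mulrn ?powR_ge0// -powRrM mulNr mulVf// powR_inv1 ?(ltW b0)//.
  by rewrite mulVf// gt_eqF.
have ab_lt : a / b < r by rewrite ltr_pdivrMr// -rE.
pose l := (a / b + r) / 2.
have l_lt : l < r by rewrite /l; lra.
have l_gt : a / b < l by rewrite /l; lra.
have l_ge0 : 0 <= l by rewrite (le_trans _ (ltW l_gt))// divr_ge0// ltW.
have /H : a < l * b by rewrite -ltr_pdivrMr.
by rewrite -rk ler_pM2r// leNgt ltrXn2r// -lt0n k0.
Qed.

Theorem theorem1p1 (G : groupType) (G_countable : countable [set: G])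
    (G_abelian : forall g h : G, (g * h = h * g)%g)
    (R : realType) (d : measure_display) (X : measurableType d)
    (mu : probability X R) (act : G -> X -> X)
    (X_Gspace : is_Gspace mu act) (X_ergodic : ergodic_action mu act)
    (k : nat) (k_gt0 : (0 < k)%N)
    (A : set G) (A_basis : ergodic_basis mu act k A)
    (B : set X) (B_measurable : measurable B)
    (B_pos : k = 1%N -> (0 < mu B)%E) :
  (mu B `^ (1 - k%:R^-1) <= mu (act_set act A B))%E.
Proof.
have [B0|B_gt0] := leP (mu B) 0%E.
  have {}B0 : mu B = 0%E by apply/eqP; rewrite eq_le B0 measure_ge0.
  rewrite B0 poweR0r ?measure_ge0//.
  apply: contraPneq B_pos => /eqP; rewrite subr_eq0 eq_sym invr_eq1 pnatr_eq1.
  by move=> /eqP k1 /(_ k1); rewrite B0 ltxx.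
have mAB := measurable_act_set G_countable X_Gspace A B B_measurable.
rewrite (massE mu B B_measurable) (massE mu _ mAB) poweR_EFin lee_fin.
apply: powR_le_of_expr_le => //; first exact: mass_ge0.
  by rewrite -lte_fin -massE.
move=> l AB_lt.
have [D [mD DB D_gt0 /(_ k) AkD_le]] :=
  plunnecke G_countable G_abelian X_Gspace A l B B_measurable AB_lt.
have l_ge0 : 0 <= l.
  by have := mass_ge0 mu B; have := mass_ge0 mu (act_set act A B); nra.
have AkD1 : mass mu (act_set act (prodset A k) D) = 1.
  apply: (congr1 fine (y := 1%E)); apply: A_basis => //.
  by rewrite (massE mu D mD) lte_fin.
by rewrite -AkD1 (le_trans AkD_le)// ler_wpM2l ?exprn_ge0// le_mass.
Qed.
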